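(* Let $T\in(0,\infty]$, let $A:U_T\to\mathcal M^{n\times n}_{\rm sym}$, $K:U_T\to\mathcal M^{n\times n}$, $B:U_T\times J\to\mathbb R^n$ be given functions, and assume there is a constant $c_0>0$ such that $\xi^{\rm T}A(x,t)\xi\ge c_0|\xi|^2$ for all $(x,t)\in U_T$ and $\xi\in\mathbb R^n$. Let $u\in C^{2,1}_{x,t}(U_T)$ with $u(U_T)\subset J$. For $\lambda\in\mathbb R$ and $C>0$, let $F_{\lambda,C}$ be any $C^2$-function on $J$ such that $$F_{\lambda,C}'(s)=Ce^{\lambda P(s)}\quad\text{for any }s\in J.$$ (i) Assume there is a constant $c_1\ge0$ such that $\xi^{\rm T}K(x,t)\xi\ge-c_1|\xi|^2$ for all $(x,t)\in U_T$ and all $\xi\in\mathbb R^n$. For any numbers $\lambda\ge c_1/c_0$ and $C>0$, the function $w=F_{\lambda,C}(u)$ satisfies $$\mathcal Lw\le F_{\lambda,C}'(u)\,Lu\quad\text{on }U_T.$$ (ii) Assume there is a constant $c_2\ge0$ such that $\xi^{\rm T}K(x,t)\xi\le c_2|\xi|^2$ for all $(x,t)\in U_T$ and all $\xi\in\mathbb R^n$. For any numbers $\lambda\le-c_2/c_0$ and $C>0$, the function $w=F_{\lambda,C}(u)$ satisfies $$\mathcal Lw\ge F_{\lambda,C}'(u)\,Lu\quad\text{on }U_T.$$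
   Context: $n\ge1$ is fixed; $U$ is a non-empty, open, bounded subset of $\mathbb R^n$. $U_T=U\times(0,T]$ for $T<\infty$ and $U_\infty=U\times(0,\infty)$. $\mathcal M^{n\times n}$ (resp. $\mathcal M^{n\times n}_{\rm sym}$) is the set of real (resp. real symmetric) $n\times n$ matrices. $C^{2,1}_{x,t}(U\times I)$, for an interval $I$, is the class of continuous functions on $U\times I$ with continuous partial derivatives $\partial u/\partial t$, $\partial u/\partial x_i$, $\partial^2u/\partial x_i\partial x_j$. $\langle A,B\rangle={\rm Tr}(A^{\rm T}B)$; $D^2u$, $\nabla u$ are the Hessian and gradient in $x$. $J$ is an interval in $\mathbb R$ with non-empty interior and $P\in C^1(J,\mathbb R)$ with $P'\in C(J,[0,\infty))$. The nonlinear operator $L$ is $$Lu=\frac{\partial u}{\partial t}-\langle A(x,t),D^2u\rangle+B(x,t,u)\cdot\nabla u+P'(u)(K(x,t)\nabla u)\cdot\nabla u.$$ For the given $u$, the linear operator $\mathcal L$ is defined for $w\in C^{2,1}_{x,t}(U_T)$ by $$\mathcal Lw=w_t-\langle A(x,t),D^2w\rangle+\widetilde B(x,t)\cdot\nabla w,\qquad\widetilde B(x,t)=B(x,t,u(x,t)).$$ *)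

(* Defs.v *)
From HB Require Import structures.
From mathcomp Require Import all_boot all_order all_algebra.
From mathcomp Require Import all_classical all_reals all_analysis.

Set Implicit Arguments.
Unset Strict Implicit.
Unset Printing Implicit Defensive.
Import Order.TTheory GRing.Theory Num.Theory.
Import numFieldNormedType.Exports.

Local Open Scope classical_set_scope.
Local Open Scope ring_scope.

Section derivative_in.
Context {R : realType}.
Implicit Types (D : set R) (f : R -> R) (x h : R).

(* Derivative relative to a set D: only increments staying in D are used, so
   it is one-sided at an endpoint of an interval and f^`() at an interior
   point; values of f outside D are irrelevant. *)
Definition diff_quot_in D f x : set_system R :=
  (fun h => h^-1 *: (f (h + x) - f x)) @ within [set h | D (h + x)] 0^'.

Definition derivable_in D f x : Prop := cvg (diff_quot_in D f x).
Definition derive_in D f x : R := lim (diff_quot_in D f x).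

Definition C1_on D f : Prop :=
  (forall x, D x -> derivable_in D f x) /\
  {within D, continuous (derive_in D f)}.

Definition C2_on D f : Prop := C1_on D f /\ C1_on D (derive_in D f).

End derivative_in.

Section space.
Context {R : realType} {n : nat}.
Implicit Types (x v w : 'cV[R]_n) (f : 'cV[R]_n -> R).

(* The norm `|v| of the library on 'cV[R]_n is the sup norm; the Euclidean
   |v|^2 is dotv v v. *)
Definition dotv v w : R := \sum_(i < n) v i 0 * w i 0.

Definition qform (M : 'M[R]_n) v : R := (v^T *m M *m v) 0 0.

Definition mxinner (M N : 'M[R]_n) : R := \tr (M^T *m N).

Definition partial (i : 'I_n) f x : R := 'D_(delta_mx i 0 : 'cV[R]_n) f x.

Definition grad f x : 'cV[R]_n := \col_i partial i f x.

Definition hessian f x : 'M[R]_n := \matrix_(i, j) partial i (partial j f) x.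

End space.

Section space_time.
Context {R : realType} {n : nat}.
Implicit Types (U : set 'cV[R]_n) (I : set R) (T : \bar R).
Implicit Types (u w : 'cV[R]_n -> R -> R).

(* (0, T] if T is finite, (0, oo) if T = +oo. *)
Definition time_interval T : set R := [set t | 0 < t /\ (t%:E <= T)%E].

Definition jointly_continuous U I u : Prop :=
  {within U `*` I, continuous (fun z : 'cV[R]_n * R => u z.1 z.2)}.

Definition dt I u : 'cV[R]_n -> R -> R := fun x t => derive_in I (u x) t.

(* Meant for U open, where the space derivatives are the usual two-sided
   ones; the time derivative is relative to I. *)
Definition C21 U I u : Prop :=
  [/\ jointly_continuous U I u,
      (forall x t, U x -> I t -> derivable_in I (u x) t) /\
      jointly_continuous U I (dt I u),
      (forall i : 'I_n,
        (forall x t, U x -> I t ->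
          derivable (u^~ t) x (delta_mx i 0 : 'cV[R]_n)) /\
        jointly_continuous U I (fun x t => partial i (u^~ t) x))
    & (forall i j : 'I_n,
        (forall x t, U x -> I t ->
          derivable (partial j (u^~ t)) x (delta_mx i 0 : 'cV[R]_n)) /\
        jointly_continuous U I
          (fun x t => partial i (partial j (u^~ t)) x))].

Definition nonlinear_op I (J : set R) (P : R -> R)
    (A K : 'cV[R]_n -> R -> 'M[R]_n) (B : 'cV[R]_n -> R -> R -> 'cV[R]_n)
    u x t : R :=
  dt I u x t - mxinner (A x t) (hessian (u^~ t) x)
  + dotv (B x t (u x t)) (grad (u^~ t) x)
  + derive_in J P (u x t)
    * dotv (K x t *m grad (u^~ t) x) (grad (u^~ t) x).

Definition linear_op I (A : 'cV[R]_n -> R -> 'M[R]_n)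
    (Bt : 'cV[R]_n -> R -> 'cV[R]_n) w x t : R :=
  dt I w x t - mxinner (A x t) (hessian (w^~ t) x)
  + dotv (Bt x t) (grad (w^~ t) x).

End space_time.

(* Main.v *)
Require Import Defs.
From HB Require Import structures.
From mathcomp Require Import all_boot all_order all_algebra.
From mathcomp Require Import all_classical all_reals all_analysis.
From mathcomp Require Import ring lra.
Set Implicit Arguments.
Unset Strict Implicit.
Unset Printing Implicit Defensive.
Import Order.TTheory GRing.Theory Num.Theory.
Import numFieldNormedType.Exports.
Local Open Scope classical_set_scope.
Local Open Scope ring_scope.

(* With w = F(u), the chain rule gives Dw = F'(u) Du and
   D^2 w = F''(u) Du Du^T + F'(u) D^2 u, and F' = C e^(lambda P) gives
   F'' = lambda P' F'.  Writing xi = Du, all terms of F'(u) Lu - Lin(w), where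
   Lin is the linear operator, cancel except
   F'(u) P'(u) (lambda xi^T A xi + xi^T K xi), whose sign is read off from
   ellipticity and the one-sided bound on K. *)

(** * Filters of admissible increments *)

(** Properness makes the limit defining [derive_in] unique. By convexity, small steps from [x]
    towards a second point [y] stay in [D], even when [x] is an endpoint. *)
Lemma is_interval_within_dnbhs_proper {R : realType} (D : set R) (x y : R) :
  is_interval D -> D x -> D y -> y != x ->
  ProperFilter (within [set h | D (h + x)] 0^').
Proof.
move=> Ditv Dx Dy yx; apply: Build_ProperFilter_ex => A.
move=> /nbhs_ballP[e /= e0 eA].
have d0 : 0 < `|y - x| by rewrite normr_gt0 subr_eq0.
have ed0 : 0 < e + `|y - x| by rewrite addr_gt0.
(* This ratio lies in [(0, 1]], so the step ends between [x] and [y], and its length [c * |y - x|]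
   is below [e]. *)
pose c := e / (e + `|y - x|).
have c0 : 0 < c by rewrite divr_gt0.
have c1 : c <= 1 by rewrite ler_pdivrMr// mul1r lerDl ltW.
exists (c * (y - x)); apply: eA => /=.
- rewrite -ball_normE /= sub0r normrN normrM gtr0_norm// /c mulrAC.
  by rewrite ltr_pdivrMr// ltr_pM2l// ltrDr.
- by rewrite mulf_neq0 ?subr_eq0// gt_eqF.
- have [xy|xy] : x < y \/ y < x.
    by move: yx; rewrite neq_lt => /orP[|]; [right|left].
  + by apply: (Ditv x y) => //; apply/andP; split; nra.
  + by apply: (Ditv y x) => //; apply/andP; split; nra.
Qed.

(** Used to compose with an outer function that is controlled only on [D]. *)
Lemma cvg_within_image {T : Type} {V : topologicalType} (F : set_system T)
    (D : set V) (g : T -> V) (y : V) : Filter F ->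
  g @ F --> y -> (\forall z \near F, D (g z)) -> g @ F `=>` within D (nbhs y).
Proof.
move=> FF gy gD A /= DA; near=> z; have : D (g z) by near: z.
near: z; exact: gy DA.
Unshelve. all: by end_near. Qed.

(** * Calculus of relative derivatives in one variable *)

Section difference_quotients.
Context {R : realType}.
Implicit Types (D : set R) (f g : R -> R) (x l m : R).

Lemma diff_quot_in_derivable D f x l :
  diff_quot_in D f x --> l -> derivable_in D f x.
Proof. by move=> fl; apply: cvgP fl. Qed.

Lemma diff_quot_in_derive D f x l :
  ProperFilter (within [set h | D (h + x)] 0^') ->
  diff_quot_in D f x --> l -> derive_in D f x = l.
Proof. by move=> PF; apply: cvg_lim. Qed.

(* Caratheodory's form of differentiability, free of division and valid at
   y = x. *)
Lemma diff_quot_in_slope D f x l : diff_quot_in D f x --> l ->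
  exists2 phi : R -> R, phi @ within D (nbhs x) --> l &
    forall y, f y - f x = phi y * (y - x).
Proof.
(* The value [l] at [x] is what makes the slope converge on all of [D], the point [x] included. *)
move=> fl; exists (fun y => if y == x then l else (f y - f x) / (y - x)).
- apply/cvgrPdist_lt => e e0.
  move/cvgrPdist_lt : fl => /(_ e e0) fl.
  have sx : (fun y => y - x) @ x --> (0 : R).
    by rewrite -(subrr x); apply: cvgB => //; exact: cvg_cst.
  have := sx _ fl; rewrite /= /within /= => Q.
  rewrite near_withinE; near=> y => Dy.
  case: eqVneq => [_|yx]; first by rewrite subrr normr0.
  have : forall (_ : y - x != 0) (_ : D (y - x + x)),
    `|l - (y - x)^-1 *: (f (y - x + x) - f x)| < e by near: y.
  by rewrite subrK subr_eq0 mulrC; exact.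
- move=> y; case: eqVneq => [->|yx]; first by rewrite !subrr mulr0.
  by rewrite divfK// subr_eq0.
Unshelve. all: by end_near. Qed.

(** In Caratheodory's form, the increment [phi y * (y - x)] tends to [l * 0]. *)
Lemma diff_quot_in_cvg D f x l : diff_quot_in D f x --> l ->
  f @ within D (nbhs x) --> f x.
Proof.
move=> /diff_quot_in_slope[phi phil fE].
have -> : f = fun y => f x + phi y * (y - x).
  by apply/funext => y; rewrite -fE addrC subrK.
rewrite subrr mulr0 -(mulr0 l).
apply: cvgD; first exact: cvg_cst.
apply: cvgM => //.
apply: (@cvg_within_filter _ _ _ (nbhs x) _ (nbhs (0 : R))).
by rewrite -(subrr x); apply: cvgB => //; exact: cvg_cst.
Qed.

(** The quotient of [f \o g] is [phi (g h)] times that of [g], with no division by [g h - a], which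
    may vanish. The general filter [G] covers both relative time derivatives and directional
    derivatives in space. *)
Lemma cvg_diff_quot_comp (G : set_system R) D f g (a l m : R) : Filter G ->
  G --> 0^' -> (\forall h \near G, D (g h)) ->
  h^-1 *: (g h - a) @[h --> G] --> l -> diff_quot_in D f a --> m ->
  h^-1 *: (f (g h) - f a) @[h --> G] --> m * l.
Proof.
move=> FG G0 GD gl /diff_quot_in_slope[phi phim fE].
have Gn0 : \forall h \near G, h != 0 by apply: G0; apply: withinT.
have ga : g @ G --> a.
  (* For [h != 0] this expression is [g h], so convergence of the quotient forces [g] to tend to
     [a]. *)
  have : (a + h * (h^-1 *: (g h - a))) @[h --> G] --> a + 0 * l.
    apply: cvgD; first exact: cvg_cst.
    apply: cvgM => //; apply: cvg_trans G0 _; exact: cvg_within.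
  rewrite mul0r addr0; apply: cvg_trans; apply: near_eq_cvg.
  near=> h; have h0 : h != 0 by near: h.
  by rewrite /GRing.scale /= mulrA divff// mul1r addrC subrK.
have -> : (fun h => h^-1 *: (f (g h) - f a)) =
          (fun h => phi (g h) * (h^-1 *: (g h - a))).
  by apply/funext => h; rewrite fE /GRing.scale /= mulrCA.
apply: cvgM => //; apply: cvg_comp phim; exact: cvg_within_image.
Unshelve. all: by end_near. Qed.

Lemma eq_diff_quot_in D f g x l : {in D, f =1 g} -> D x ->
  diff_quot_in D f x --> l -> diff_quot_in D g x --> l.
Proof.
move=> fg Dx; apply: cvg_trans; apply: near_eq_cvg.
apply: (filterS _ (withinT [set h | D (h + x)] _)) => h /= Dh.
by rewrite !fg// inE.
Qed.

Lemma diff_quot_in_comp I D f g x l m : (forall y, I y -> D (g y)) ->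
  diff_quot_in I g x --> l -> diff_quot_in D f (g x) --> m ->
  diff_quot_in I (f \o g) x --> m * l.
Proof.
move=> gD gl fm.
apply: (@cvg_diff_quot_comp _ D f (fun h => g (h + x)) (g x)) => //.
- exact: cvg_within.
- by apply: (filterS _ (withinT [set h | I (h + x)] _)) => h; exact: gD.
Qed.

Lemma is_derive_diff_quot_in f x l : is_derive x 1 f l ->
  diff_quot_in setT f x --> l.
Proof.
move=> [fx <-]; apply: cvg_within_filter; move: fx.
rewrite /derivable /derive /=.
by under eq_fun do rewrite /GRing.scale /= mulr1.
Qed.

Lemma C1_on_continuous D f : C1_on D f -> {within D, continuous f}.
Proof.
move=> [fD _]; apply/subspace_continuousP => x /fD; exact: diff_quot_in_cvg.
Qed.

End difference_quotients.

(** * Chain rule for directional derivatives *)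

Section directional_derivatives.
Context {R : realType} {V : normedModType R}.
Implicit Types (f g : V -> R) (x v : V).

(** The outer derivative is relative to [D], since [f x] may be an endpoint of [D]. It suffices that
    [f] takes values in [D] near [x]. *)
Lemma is_derive_comp_in (D : set R) (F : R -> R) f x v (l m : R) :
  (\forall y \near x, D (f y)) -> is_derive x v f l ->
  diff_quot_in D F (f x) --> m -> is_derive x v (F \o f) (m * l).
Proof.
move=> fD [fv <-] Fm.
have qFm : h^-1 *: ((F \o f \o shift x) (h *: v) - F (f x)) @[h --> 0^'] -->
           m * 'D_v f x.
  apply: (@cvg_diff_quot_comp _ _ D F (fun h => f (h *: v + x)) (f x)) => //.
  (* Along the line through [x] in direction [v], [f] therefore stays in [D] for small [h]. *)
  have vx : h *: v + x @[h --> (0 : R)] --> x.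
    rewrite -[X in _ --> X]add0r -(scale0r v).
    by apply: cvgD; [exact: cvgZr_tmp|exact: cvg_cst].
  have fvD : \forall h \near (0 : R), D (f (h *: v + x)) by exact: vx fD.
  by rewrite near_withinE; apply: filterS fvD.
by split; [exact: cvgP qFm|exact: cvg_lim qFm].
Qed.

End directional_derivatives.

(** * Continuity relative to a set *)

Section within_continuity.
Context {R : realType} {T : topologicalType}.
Implicit Types (E : set T) (f g : T -> R).

Lemma within_continuous_comp_in E (D : set R) (F : R -> R) f :
  (forall z, E z -> D (f z)) -> {within D, continuous F} ->
  {within E, continuous f} -> {within E, continuous (F \o f)}.
Proof.
move=> fD /subspace_continuousP FD /subspace_continuousP fE.
apply/subspace_continuousP => z Ez.
apply: cvg_comp (FD _ (fD _ Ez)).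
apply: cvg_within_image; first exact: fE.
by apply: (filterS _ (withinT E _)) => y; exact: fD.
Qed.

Lemma within_continuousM E f g : {within E, continuous f} ->
  {within E, continuous g} -> {within E, continuous (f \* g)}.
Proof. by move=> fE gE z; apply: cvgM; [exact: fE|exact: gE]. Qed.

Lemma within_continuousD E f g : {within E, continuous f} ->
  {within E, continuous g} -> {within E, continuous (f \+ g)}.
Proof. by move=> fE gE z; apply: cvgD; [exact: fE|exact: gE]. Qed.

End within_continuity.

(** * Derivatives and regularity of [w = F(u)] *)

Section composition.
Context {R : realType} {n : nat}.
Variables (U : set 'cV[R]_n) (I J : set R) (u : 'cV[R]_n -> R -> R).
Variable F : R -> R.
Hypothesis U_open : open U.
Hypothesis I_proper :
  forall t, I t -> ProperFilter (within [set h | I (h + t)] 0^').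
Hypothesis u_C21 : C21 U I u.
Hypothesis u_J : forall x t, U x -> I t -> J (u x t).
Hypothesis F_C2 : C2_on J F.

Let F' := derive_in J F.
Let F'' := derive_in J F'.
Let w x t := F (u x t).

Let F_derivable s : J s -> diff_quot_in J F s --> F' s.
Proof. by case: F_C2 => -[FD _] _ /FD. Qed.

Let F'_derivable s : J s -> diff_quot_in J F' s --> F'' s.
Proof. by case: F_C2 => _ [F'D _] /F'D. Qed.

Let near_u_J x t : U x -> I t -> \forall y \near x, J (u y t).
Proof.
move=> Ux It; have := open_nbhs_nbhs (conj U_open Ux).
by apply: filterS => y Uy; exact: u_J.
Qed.

Lemma diff_quot_in_dt_comp x t : U x -> I t ->
  diff_quot_in I (w x) t --> F' (u x t) * dt I u x t.
Proof.
move=> Ux It; apply: (@diff_quot_in_comp _ I J F (u x) t).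
- by move=> y; exact: u_J.
- by case: u_C21 => _ [/(_ x t Ux It)].
- exact/F_derivable/u_J.
Qed.

Lemma dt_comp x t : U x -> I t -> dt I w x t = F' (u x t) * dt I u x t.
Proof.
move=> Ux It; have ? := I_proper It.
by apply: diff_quot_in_derive; exact: diff_quot_in_dt_comp.
Qed.

Lemma is_derive_comp_space x t i : U x -> I t ->
  is_derive x (delta_mx i 0 : 'cV[R]_n) (w^~ t)
    (F' (u x t) * partial i (u^~ t) x).
Proof.
move=> Ux It; apply: (@is_derive_comp_in _ _ J F (u^~ t)).
- exact: near_u_J.
- by apply: derivableP; case: u_C21 => _ _ /(_ i)[+ _] _; exact.
- exact/F_derivable/u_J.
Qed.

Lemma partial_comp x t i : U x -> I t ->
  partial i (w^~ t) x = F' (u x t) * partial i (u^~ t) x.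
Proof. by move=> Ux It; have [] := is_derive_comp_space i Ux It. Qed.

(** Product rule for [F'(u) * partial j u], where [F'(u)] is differentiated by the chain rule
    relative to [J]. *)
Lemma is_derive_partial_comp x t i j : U x -> I t ->
  is_derive x (delta_mx i 0 : 'cV[R]_n) (partial j (w^~ t))
    (F'' (u x t) * partial i (u^~ t) x * partial j (u^~ t) x
     + F' (u x t) * partial i (partial j (u^~ t)) x).
Proof.
move=> Ux It.
(* Differentiating the first-order formula requires it in a neighbourhood of [x], which openness of
   [U] provides. *)
apply: (@near_eq_is_derive _ _ _ ((F' \o u^~ t) * partial j (u^~ t))).
  have := open_nbhs_nbhs (conj U_open Ux).
  by apply: filterS => y Uy; rewrite partial_comp.
have du : is_derive x (delta_mx i 0 : 'cV[R]_n) (u^~ t) (partial i (u^~ t) x).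
  by apply: derivableP; case: u_C21 => _ _ /(_ i)[+ _] _; exact.
have ddu : is_derive x (delta_mx i 0 : 'cV[R]_n) (partial j (u^~ t))
    (partial i (partial j (u^~ t)) x).
  by apply: derivableP; case: u_C21 => _ _ _ /(_ i j)[+ _]; exact.
have dF := is_derive_comp_in (near_u_J Ux It) du (F'_derivable (u_J Ux It)).
(* Instance search assembles the product rule from [dF] and [ddu]. *)
apply: is_derive_eq.
by rewrite addrC /GRing.scale /= [X in X + _]mulrC.
Qed.

Lemma partial_partial_comp x t i j : U x -> I t ->
  partial i (partial j (w^~ t)) x =
  F'' (u x t) * partial i (u^~ t) x * partial j (u^~ t) x
  + F' (u x t) * partial i (partial j (u^~ t)) x.
Proof. by move=> Ux It; have [] := is_derive_partial_comp i j Ux It. Qed.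

Let jointly_continuous_comp (G : R -> R) : {within J, continuous G} ->
  jointly_continuous U I (fun x t => G (u x t)).
Proof.
move=> GJ; case: u_C21 => uc _ _ _.
apply: (@within_continuous_comp_in _ _ _ J G (fun z => u z.1 z.2)) => //.
by move=> z [Uz Iz]; exact: u_J.
Qed.

Let eq_jointly_continuous (f g : 'cV[R]_n -> R -> R) :
  (forall x t, U x -> I t -> f x t = g x t) ->
  jointly_continuous U I f -> jointly_continuous U I g.
Proof.
by move=> fg; apply: subspace_eq_continuous => z /set_mem[Uz Iz]; exact: fg.
Qed.

(** On [U] and [I], each derivative of [w] equals a polynomial in derivatives of [u] and in [F'(u)],
    [F''(u)], all jointly continuous. *)
Lemma C21_comp : C21 U I w.
Proof.
have Fc := jointly_continuous_comp (C1_on_continuous F_C2.1).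
have F'c := jointly_continuous_comp F_C2.1.2.
have F''c := jointly_continuous_comp F_C2.2.2.
have [_ [_ utc] uxc uxxc] := u_C21; split; first exact: Fc.
- split=> [x t Ux It|].
    exact: diff_quot_in_derivable (diff_quot_in_dt_comp Ux It).
  apply: (@eq_jointly_continuous (fun x t => F' (u x t) * dt I u x t)).
    by move=> x t Ux It; rewrite dt_comp.
  exact: within_continuousM F'c utc.
- move=> i; split=> [x t Ux It|].
    by have [] := is_derive_comp_space i Ux It.
  apply: (@eq_jointly_continuous
    (fun x t => F' (u x t) * partial i (u^~ t) x)).
    by move=> x t Ux It; rewrite partial_comp.
  exact: within_continuousM F'c (uxc i).2.
- move=> i j; split=> [x t Ux It|].
    by have [] := is_derive_partial_comp i j Ux It.
  apply: (@eq_jointly_continuous (fun x t =>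
    F'' (u x t) * partial i (u^~ t) x * partial j (u^~ t) x
    + F' (u x t) * partial i (partial j (u^~ t)) x)).
    by move=> x t Ux It; rewrite partial_partial_comp.
  apply: within_continuousD (within_continuousM F'c (uxxc i j).2).
  exact: within_continuousM (within_continuousM F''c (uxc i).2) (uxc j).2.
Qed.

Lemma grad_comp x t : U x -> I t ->
  grad (w^~ t) x = F' (u x t) *: grad (u^~ t) x.
Proof. by move=> Ux It; apply/colP => i; rewrite !mxE partial_comp. Qed.

Lemma hessian_comp x t : U x -> I t ->
  hessian (w^~ t) x =
  F'' (u x t) *: (grad (u^~ t) x *m (grad (u^~ t) x)^T)
  + F' (u x t) *: hessian (u^~ t) x.
Proof.
move=> Ux It; apply/matrixP => i j.
by rewrite !mxE big_ord1 !mxE partial_partial_comp// mulrA.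
Qed.

End composition.

(** * Linear algebra for the quadratic forms *)

Section bilinear.
Context {R : realType} {n : nat}.
Implicit Types (M N : 'M[R]_n) (v w : 'cV[R]_n).

Lemma dotvZr a v w : dotv v (a *: w) = a * dotv v w.
Proof.
by rewrite /dotv mulr_sumr; apply: eq_bigr => i _; rewrite mxE mulrCA.
Qed.

Lemma dotv_mulmx M v : dotv (M *m v) v = qform M v.
Proof.
rewrite /qform -mulmxA [RHS]mxE; apply: eq_bigr => i _.
by rewrite [in RHS]mxE mulrC.
Qed.

Lemma mxinnerDr M N1 N2 : mxinner M (N1 + N2) = mxinner M N1 + mxinner M N2.
Proof. by rewrite /mxinner mulmxDr mxtraceD. Qed.

Lemma mxinnerZr a M N : mxinner M (a *: N) = a * mxinner M N.
Proof. by rewrite /mxinner -scalemxAr mxtraceZ. Qed.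

(** Cyclicity reduces the trace to that of the 1 by 1 matrix [v^T *m M^T *m v], whose transpose is
    [v^T *m M *m v]. *)
Lemma mxinner_outer M v : mxinner M (v *m v^T) = qform M v.
Proof.
rewrite /mxinner mulmxA mxtrace_mulC -[LHS]mxtrace_tr !trmx_mul !trmxK.
by rewrite trace_mx11.
Qed.

Lemma dotvv_ge0 v : 0 <= dotv v v.
Proof. by apply: sumr_ge0 => i _; exact: sqr_ge0. Qed.

End bilinear.

(** * Uniqueness of derivatives on the two intervals in play *)

(** The point [t / 2] serves as second point of the interval; it lies to the left of [t], so the
    final time [t = T] is covered too. *)
Lemma time_interval_proper {R : realType} (T : \bar R) (t : R) :
  time_interval T t ->
  ProperFilter (within [set h | time_interval T (h + t)] 0^').
Proof.
move=> [t0 tT]; apply: (@is_interval_within_dnbhs_proper _ _ _ (t / 2)).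
- move=> a b [a0 _] [_ bT] c /andP[ac cb]; split; first exact: lt_le_trans ac.
  by apply: le_trans bT; rewrite lee_fin.
- by [].
- split; first by rewrite divr_gt0.
  by apply: le_trans tT; rewrite lee_fin; lra.
- by apply/eqP; lra.
Qed.

Lemma interval_proper {R : realType} (J : set R) (s : R) :
  is_interval J -> interior J !=set0 -> J s ->
  ProperFilter (within [set h | J (h + s)] 0^').
Proof.
move=> Jitv [p /nbhs_ballP[e /= e0 eJ]] Js.
have Jp : J p by apply: eJ; exact: ballxx.
have Jq : J (p + e / 2).
  apply: eJ; rewrite -ball_normE /= opprD addrA subrr sub0r normrN.
  by rewrite gtr0_norm; lra.
(* Of the two distinct points [p] and [p + e / 2] of [J], at least one differs from [s]. *)
have [ps|ps] := eqVneq p s.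
  apply: (@is_interval_within_dnbhs_proper _ _ _ (p + e / 2)) => //.
  by apply/eqP; lra.
exact: (@is_interval_within_dnbhs_proper _ _ _ p).
Qed.

(** * The exponential choice of [F'] and the comparison of the operators *)

(** Applied to [f = F'], this is the equation [F'' = lambda P' F']. *)
Lemma derive_in_expR {R : realType} (J : set R) (P f : R -> R)
    (lambda C s : R) :
  ProperFilter (within [set h | J (h + s)] 0^') -> J s -> derivable_in J P s ->
  (forall r, J r -> f r = C * expR (lambda * P r)) ->
  derive_in J f s = lambda * derive_in J P s * f s.
Proof.
move=> Jproper Js Pd fE; apply: diff_quot_in_derive.
apply: (@eq_diff_quot_in _ J ((fun y => C * expR (lambda * y)) \o P)) => //.
  by move=> r /set_mem /fE.
rewrite fE//.
(* Regrouped as outer derivative at [P s] times inner derivative, the shape produced by the chain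
   rule. *)
have -> : lambda * derive_in J P s * (C * expR (lambda * P s)) =
          C * (expR (lambda * P s) * lambda) * derive_in J P s by ring.
apply: (@diff_quot_in_comp _ J setT) => //.
apply: is_derive_diff_quot_in.
have dM : is_derive (P s) 1 (fun y : R => lambda * y) lambda.
  apply: is_derive_eq (is_deriveZ lambda (is_derive_id (P s) 1)) _.
  exact: mulr1.
have dE := @is_derive1_comp _ expR _ _ _ _ (is_derive_expR _) dM.
exact: (is_deriveZ C dE).
Qed.

(** An exact identity serving both halves of the theorem, which differ only in the sign of the last
    factor. *)
Lemma linear_op_comp {R : realType} {n : nat} (U : set 'cV[R]_n) (I J : set R)
    (A K : 'cV[R]_n -> R -> 'M[R]_n) (B : 'cV[R]_n -> R -> R -> 'cV[R]_n)
    (u : 'cV[R]_n -> R -> R) (P F : R -> R) (lambda C : R) x t :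
  open U -> (forall t, I t -> ProperFilter (within [set h | I (h + t)] 0^')) ->
  (forall s, J s -> ProperFilter (within [set h | J (h + s)] 0^')) ->
  C21 U I u -> (forall x t, U x -> I t -> J (u x t)) ->
  C1_on J P -> C2_on J F ->
  (forall s, J s -> derive_in J F s = C * expR (lambda * P s)) ->
  U x -> I t ->
  let xi := grad (u^~ t) x in
  derive_in J F (u x t) * nonlinear_op I J P A K B u x t
  - linear_op I A (fun y s => B y s (u y s)) (fun x t => F (u x t)) x t =
  derive_in J F (u x t) * derive_in J P (u x t)
  * (lambda * qform (A x t) xi + qform (K x t) xi).
Proof.
move=> Uo Ip Jp uC uJ PC FC FE Ux It xi; have Ju := uJ _ _ Ux It.
rewrite /nonlinear_op /linear_op (dt_comp Ip uC uJ FC Ux It).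
rewrite (grad_comp Uo uC uJ FC Ux It) (hessian_comp Uo uC uJ FC Ux It) -/xi.
rewrite (derive_in_expR (Jp _ Ju) Ju (PC.1 _ Ju) FE).
rewrite dotvZr dotv_mulmx mxinnerDr !mxinnerZr mxinner_outer.
ring.
Qed.

(** Each conclusion includes [C21] for [w], so that the linear operator acts on a function of the
    class where it is defined. *)
Theorem lemma5p1 (R : realType) (n : nat) (n_ge1 : (1 <= n)%N)
    (U : set 'cV[R]_n) (U_neq0 : U !=set0) (U_open : open U)
    (U_bounded : bounded_set U)
    (J : set R) (J_itv : is_interval J) (J_int : interior J !=set0)
    (P : R -> R) (P_C1 : C1_on J P)
    (dP_ge0 : forall s, J s -> 0 <= derive_in J P s)
    (T : \bar R) (T_gt0 : (0 < T)%E)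
    (A K : 'cV[R]_n -> R -> 'M[R]_n)
    (B : 'cV[R]_n -> R -> R -> 'cV[R]_n)
    (A_sym : forall x t, U x -> time_interval T t -> (A x t)^T = A x t)
    (c0 : R) (c0_gt0 : 0 < c0)
    (A_ell : forall x t, U x -> time_interval T t ->
       forall xi : 'cV[R]_n, c0 * dotv xi xi <= qform (A x t) xi)
    (u : 'cV[R]_n -> R -> R)
    (u_C21 : C21 U (time_interval T) u)
    (u_J : forall x t, U x -> time_interval T t -> J (u x t)) :
  (forall c1 : R, 0 <= c1 ->
    (forall x t, U x -> time_interval T t ->
       forall xi : 'cV[R]_n, - c1 * dotv xi xi <= qform (K x t) xi) ->
    forall (lambda C : R) (F : R -> R),
      c1 / c0 <= lambda -> 0 < C -> C2_on J F ->
      (forall s, J s -> derive_in J F s = C * expR (lambda * P s)) ->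
      let w := fun x t => F (u x t) in
      C21 U (time_interval T) w /\
      forall x t, U x -> time_interval T t ->
        linear_op (time_interval T) A (fun y s => B y s (u y s)) w x t
        <= derive_in J F (u x t)
           * nonlinear_op (time_interval T) J P A K B u x t)
  /\
  (forall c2 : R, 0 <= c2 ->
    (forall x t, U x -> time_interval T t ->
       forall xi : 'cV[R]_n, qform (K x t) xi <= c2 * dotv xi xi) ->
    forall (lambda C : R) (F : R -> R),
      lambda <= - c2 / c0 -> 0 < C -> C2_on J F ->
      (forall s, J s -> derive_in J F s = C * expR (lambda * P s)) ->
      let w := fun x t => F (u x t) in
      C21 U (time_interval T) w /\
      forall x t, U x -> time_interval T t ->
        derive_in J F (u x t)
        * nonlinear_op (time_interval T) J P A K B u x t
        <= linear_op (time_interval T) A (fun y s => B y s (u y s)) w x t).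
Proof.
have Ip := @time_interval_proper R T.
have Jp s : J s -> _ := interval_proper J_itv J_int.
split=> [c1 c1_ge0 K_ge|c2 c2_ge0 K_le] lambda C F lambdaP C_gt0 F_C2 F'E w.
all: split; first exact: C21_comp U_open Ip u_C21 u_J F_C2.
all: move=> x t Ux It; have Ju := u_J _ _ Ux It.
all: have F'_ge0 : 0 <= derive_in J F (u x t).
(* [F'] is a positive constant times an exponential. *)
1,3: by rewrite F'E// mulr_ge0// ?expR_ge0// ltW.
all: have P'_ge0 := dP_ge0 _ Ju.
all: have Axi := A_ell _ _ Ux It (grad (u^~ t) x).
all: have xi_ge0 := dotvv_ge0 (grad (u^~ t) x).
- rewrite -subr_ge0.
  rewrite (linear_op_comp _ _ _ U_open Ip Jp u_C21 u_J P_C1 F_C2 F'E Ux It).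
  have Kxi := K_ge _ _ Ux It (grad (u^~ t) x).
  rewrite ler_pdivrMr// in lambdaP.
  apply: mulr_ge0; first exact: mulr_ge0.
  (* Since [lambda >= 0], ellipticity gives [lambda xi^T A xi >= lambda c0 |xi|^2 >= c1 |xi|^2],
     which absorbs the lower bound on [K]. *)
  have lambda_ge0 : 0 <= lambda by nra.
  nra.
- rewrite -subr_le0.
  rewrite (linear_op_comp _ _ _ U_open Ip Jp u_C21 u_J P_C1 F_C2 F'E Ux It).
  have Kxi := K_le _ _ Ux It (grad (u^~ t) x).
  rewrite ler_pdivlMr// in lambdaP.
  apply: mulr_ge0_le0; first exact: mulr_ge0.
  (* Since [lambda <= 0], ellipticity is reversed: [lambda xi^T A xi <= lambda c0 |xi|^2 <= - c2
     |xi|^2], which offsets the upper bound on [K]. *)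
  have lambda_le0 : lambda <= 0 by nra.
  nra.
Qed.
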